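(* Let $\alpha_1,\alpha_2:[0,1]\to\mathbb{S}^2$ be smooth trajectories with starting points $p_1=\alpha_1(0)$, $p_2=\alpha_2(0)$, and for a smooth trajectory $\alpha$ let $q_\alpha$ denote its transported square-root vector curve (TSRVC). Then for every $\gamma\in\Gamma$ (orientation-preserving diffeomorphisms of $[0,1]$), $$d\big((p_1,q_{\alpha_1\circ\gamma}),(p_2,q_{\alpha_2\circ\gamma})\big)=d\big((p_1,q_{\alpha_1}),(p_2,q_{\alpha_2})\big).$$
   Context: $\mathbb{S}^2\subset\mathbb{R}^3$ is the unit sphere with the Riemannian metric induced by the Euclidean inner product; $|\cdot|$ is the induced norm on tangent spaces. $\Gamma=\{\gamma:[0,1]\to[0,1] : \gamma(0)=0,\ \gamma(1)=1,\ \gamma \text{ is a diffeomorphism}\}$. TSRVC: for a smooth trajectory $\alpha:[0,1]\to\mathbb{S}^2$ with $\alpha(0)=p$, its TSRVC is the curve $q_\alpha:[0,1]\to T_p(\mathbb{S}^2)$ given by $$q_\alpha(t)=\left(\frac{\dot\alpha(t)}{\sqrt{|\dot\alpha(t)|}}\right)_{\alpha(t)\to p},$$ where $(\cdot)_{\alpha(t)\to p}$ denotes parallel transport along $\alpha$ itself from $T_{\alpha(t)}(\mathbb{S}^2)$ back to $T_p(\mathbb{S}^2)$, with the convention $q_\alpha(t)=0$ where $\dot\alpha(t)=0$. Note $(\alpha\circ\gamma)(0)=\alpha(0)$ for $\gamma\in\Gamma$. Representation space: $\mathcal{C}=\coprod_{p\in\mathbb{S}^2}L^2([0,1],T_p(\mathbb{S}^2))$;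 a trajectory $\alpha$ is represented by the pair $(\alpha(0),q_\alpha)\in\mathcal{C}$. Distance: for $(p_1,q_1),(p_2,q_2)\in\mathcal{C}$, $$d((p_1,q_1),(p_2,q_2))=\inf_{\beta\in\mathcal{B}}\sqrt{\,l_\beta^2+\int_0^1\big|q^{\parallel}_{1,\beta}(t)-q_2(t)\big|^2\,dt\,},$$ where $\mathcal{B}$ is the set of smooth curves $\beta:[0,1]\to\mathbb{S}^2$ with $\beta(0)=p_1$, $\beta(1)=p_2$ and $|\dot\beta(s)|$ constant, $l_\beta^2=\int_0^1|\dot\beta(s)|^2\,ds$ is the squared length of $\beta$, and $q^{\parallel}_{1,\beta}(t)\in T_{p_2}(\mathbb{S}^2)$ is the parallel transport of $q_1(t)\in T_{p_1}(\mathbb{S}^2)$ along $\beta$ from $p_1$ to $p_2$. *)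

(* Defs.v *)
From HB Require Import structures.
From mathcomp Require Import all_boot all_order all_algebra.
From mathcomp Require Import all_classical all_reals all_analysis.

Set Implicit Arguments.
Unset Strict Implicit.
Unset Printing Implicit Defensive.

Import Order.TTheory GRing.Theory Num.Theory.
Import numFieldNormedType.Exports.

Local Open Scope classical_set_scope.
Local Open Scope ring_scope.

(* A map on [0, 1] is represented by a total function on R. Every notion below
   depends only on the values of that function on [0, 1]; in particular
   derivatives at 0 and 1 are one-sided. *)
Definition quot01 (R : realType) (V : normedModType R) (f : R -> V) (t : R) :
  set_system V :=
  (fun s : R => (s - t)^-1 *: (f s - f t)) @ within `[0, 1] t^'.

Definition derivable01 (R : realType) (V : normedModType R) (f : R -> V)
  (t : R) : Prop := cvg (quot01 f t).

Definition deriv01 (R : realType) (V : normedModType R) (f : R -> V) (t : R) :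
  V := lim (quot01 f t).

Definition smooth01 (R : realType) (V : normedModType R) (f : R -> V) : Prop :=
  forall (n : nat) (t : R), `[0, 1]%classic t ->
    derivable01 (iter n (@deriv01 R V) f) t.

Definition dot (R : realType) (u v : 'rV[R]_3) : R :=
  \sum_(i < 3) u 0 i * v 0 i.

(* The library norm `|v| on 'rV_3 is the sup norm; it is only used for the
   topology. *)
Definition enorm (R : realType) (v : 'rV[R]_3) : R := Num.sqrt (dot v v).

Definition sphere (R : realType) : set 'rV[R]_3 := [set p | enorm p = 1].

Definition tangent (R : realType) (p : 'rV[R]_3) : set 'rV[R]_3 :=
  [set v | dot p v = 0].

Definition trajectory (R : realType) (alpha : R -> 'rV[R]_3) : Prop :=
  smooth01 alpha /\ forall t : R, `[0, 1]%classic t -> sphere (alpha t).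

(* The Levi-Civita covariant derivative of the round metric along beta: the
   orthogonal projection of the ambient derivative onto the tangent space. *)
Definition covderiv01 (R : realType) (beta V : R -> 'rV[R]_3) (t : R) :
  'rV[R]_3 :=
  deriv01 V t - dot (beta t) (deriv01 V t) *: beta t.

Definition parallel (R : realType) (beta V : R -> 'rV[R]_3) : Prop :=
  forall t : R, `[0, 1]%classic t ->
    [/\ tangent (beta t) (V t), derivable01 V t & covderiv01 beta V t = 0].

(* Parallel transport along beta from beta a to beta b of v tangent at beta a.
   When beta is a trajectory, a, b lie in [0, 1] and v is tangent at beta a,
   the set below is a singleton: a parallel field with a prescribed value at a
   exists (linear ODE) and is unique. *)
Definition transport (R : realType) (beta : R -> 'rV[R]_3) (a b : R)
  (v : 'rV[R]_3) : 'rV[R]_3 :=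
  xget 0 [set w | exists V : R -> 'rV[R]_3,
                    [/\ parallel beta V, V a = v & V b = w]].

Definition tsrvc (R : realType) (alpha : R -> 'rV[R]_3) (t : R) : 'rV[R]_3 :=
  if deriv01 alpha t == 0 then 0
  else transport alpha t 0
         ((Num.sqrt (enorm (deriv01 alpha t)))^-1 *: deriv01 alpha t).

Definition baseline (R : realType) (p1 p2 : 'rV[R]_3) : set (R -> 'rV[R]_3) :=
  [set beta | [/\ trajectory beta, beta 0 = p1, beta 1 = p2 &
     exists c : R, forall s : R, `[0, 1]%classic s ->
       enorm (deriv01 beta s) = c]].

Definition sqlength (R : realType) (beta : R -> 'rV[R]_3) : \bar R :=
  (\int[lebesgue_measure]_(s in `[0%R, 1%R]) (enorm (deriv01 beta s) ^+ 2)%:E)%E.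

(* An element of the disjoint union of the spaces L^2([0,1], T_p S^2) is given
   by its base point p and a representative q of the class. On such pairs the
   integrals below do not depend on the representatives and are finite; the
   formula is totalised with values in \bar R. *)
Definition repr_dist (R : realType)
  (x y : 'rV[R]_3 * (R -> 'rV[R]_3)) : \bar R :=
  ereal_inf [set sqrte (sqlength beta +
      \int[lebesgue_measure]_(t in `[0%R, 1%R])
        (enorm (transport beta 0 1 (x.2 t) - y.2 t) ^+ 2)%:E)%E
    | beta in baseline x.1 y.1].

Definition maps01 (R : realType) (g : R -> R) : Prop :=
  forall t : R, `[0, 1]%classic t -> `[0, 1]%classic (g t).

Definition diffeo01 (R : realType) (g : R -> R) : Prop :=
  [/\ maps01 g, smooth01 (g : R -> R^o) &
    exists h : R -> R, [/\ maps01 h, smooth01 (h : R -> R^o),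
      (forall t : R, `[0, 1]%classic t -> h (g t) = t) &
      (forall t : R, `[0, 1]%classic t -> g (h t) = t)]].

Definition Gamma (R : realType) : set (R -> R) :=
  [set g | [/\ g 0 = 0, g 1 = 1 & diffeo01 g]].

(* Main.v *)
Require Import Defs.
From HB Require Import structures.
From mathcomp Require Import all_boot all_order all_algebra.
From mathcomp Require Import all_classical all_reals all_analysis.
From mathcomp Require Import measurable_realfun.

(* The chain rule and the invariance of parallel transport under
   reparametrisation give
     q_(alpha o gamma)(t) = sqrt(gamma'(t)) q_alpha(gamma(t)).
   Transport along a fixed beta is homogeneous, so the integrand of the distance
   for the reparametrised pair is gamma'(t) Phi(gamma(t)), where Phi is the
   original integrand; substituting s = gamma(t) shows that every beta has the
   same cost for both pairs.

   Existence of parallel fields is never used: where none exists, both sides of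
   each identity take the same default value 0. The price is that Phi is not
   known to be measurable, so the substitution is proved for arbitrary
   nonnegative functions, whose integral is a supremum over the simple functions
   below: one inequality holds for gamma and, applied to the inverse of gamma,
   gives the other. *)

Set Implicit Arguments.
Unset Strict Implicit.
Unset Printing Implicit Defensive.

Import Order.TTheory GRing.Theory Num.Theory.
Import numFieldNormedType.Exports.
Import HBNNSimple.

Local Open Scope classical_set_scope.
Local Open Scope ring_scope.

(** * One-sided calculus on [0, 1] *)

(** Uniqueness of the limit in [deriv01] rests on this, at the endpoints too: from every t in [0, 1]
    there is room of length at least 1/2 on one side. *)
Lemma within01_proper (R : realType) (t : R) : `[0, 1]%classic t ->
  ProperFilter (within `[0, 1] t^').
Proof.
rewrite /= in_itv /= => /andP[t0 t1].
split; last by apply: within_filter.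
move=> /nbhs_ballP[e /= e0 /= h].
have [t12|t12] := leP t (1/2).
  (* The bound e / 2 keeps the shifted point in the ball, the bound 1 / 2 keeps it in [0, 1]. *)
  have hm : 0 < Num.min (e / 2) (1 / 2) by rewrite lt_min !divr_gt0.
  have /= := h (t + Num.min (e / 2) (1 / 2)).
  apply.
  - rewrite /ball /= opprD addrA subrr add0r normrN gtr0_norm //.
    by rewrite gt_min ltr_pdivrMr// mulr_natr mulr2n ltrDl e0.
  - by rewrite -subr_eq0 addrAC subrr add0r gt_eqF.
  rewrite in_itv /= addr_ge0 ?(ltW hm)//=.
  by rewrite [leRHS](splitr 1) lerD// ge_min lexx orbT.
have hm : 0 < Num.min (e / 2) (1 / 2) by rewrite lt_min !divr_gt0.
have /= := h (t - Num.min (e / 2) (1 / 2)).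
apply.
- rewrite /ball /= opprB addrCA subrr addr0 gtr0_norm //.
  by rewrite gt_min ltr_pdivrMr// mulr_natr mulr2n ltrDl e0.
- by rewrite -subr_eq0 addrAC subrr add0r oppr_eq0 gt_eqF.
rewrite in_itv /= subr_ge0 ge_min (ltW t12) orbT /=.
by rewrite lerBlDr (le_trans t1)// lerDl ltW.
Qed.

Lemma deriv01_cvg (R : realType) (V : normedModType R) (f : R -> V) (t : R) :
  derivable01 f t -> quot01 f t --> deriv01 f t.
Proof. by []. Qed.

Lemma cvg_deriv01 (R : realType) (V : normedModType R) (f : R -> V) (t : R)
    (l : V) : `[0, 1]%classic t -> quot01 f t --> l ->
  derivable01 f t /\ deriv01 f t = l.
Proof.
move=> t01 fl; have ? := within01_proper t01.
by split; [apply/cvg_ex; exists l | apply: cvg_lim].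
Qed.

(** f s is f t plus (s - t) times the difference quotient, and this product tends to 0. *)
Lemma derivable01_cvg (R : realType) (V : normedModType R) (f : R -> V)
    (t : R) : derivable01 f t -> f @ within `[0, 1] t^' --> f t.
Proof.
move=> /deriv01_cvg fl.
have -> : f t = f t + (t - t) *: deriv01 f t by rewrite subrr scale0r addr0.
apply: (@cvg_trans _ ((fun s => f t +
   (s - t) *: ((s - t)^-1 *: (f s - f t))) @ within `[0, 1] t^')).
  apply: near_eq_cvg; apply/nbhs_ballP; exists 1 => //= s _ st _.
  by rewrite scalerA divff ?scale1r ?subr_eq0// addrC subrK.
apply: cvgD; first exact: cvg_cst.
apply: cvgZ => //; apply: cvgB; last exact: cvg_cst.
apply: cvg_trans; last exact: (@cvg_id _ (nbhs t)).
apply: cvg_trans; first exact: cvg_within.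
exact: cvg_within.
Qed.

Lemma derivable01_continuous (R : realType) (V : normedModType R) (f : R -> V)
    (a b : R) : 0 <= a -> b <= 1 ->
  (forall t, `[0, 1]%classic t -> derivable01 f t) ->
  {within `[a, b], continuous f}.
Proof.
move=> a0 b1 df.
apply: (@continuous_subspaceW _ _ `[a, b]%classic `[0, 1]%classic).
  by apply: subset_itv; rewrite ?bnd_simp.
apply/subspace_continuousP => t t01.
have ft := derivable01_cvg (df _ t01).
apply/cvgrPdist_lt => e e0.
move/cvgrPdist_lt/(_ _ e0) : ft => /nbhs_ballP[d /= d0 h].
apply/nbhs_ballP; exists d => //= s sd s01.
have [->|st] := eqVneq s t; first by rewrite subrr normr0.
exact: h.
Qed.

(** Link to the two-sided derivative, in terms of which the mean value theorem and the fundamental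
    theorem of calculus are phrased. *)
Lemma deriv01_is_derive (R : realType) (f : R -> R) (t : R) :
  0 < t < 1 -> derivable01 (f : R -> R^o) t ->
  is_derive t 1 f (deriv01 (f : R -> R^o) t).
Proof.
move=> /andP[t0 t1] /deriv01_cvg ft.
have hl : h^-1 *: ((f \o shift t) (h *: 1) - f t) @[h --> 0^'] -->
    (deriv01 (f : R -> R^o) t : R).
  move=> A /ft /nbhs_ballP[d /= d0 hA].
  (* The bounds t and 1 - t keep s + t inside [0, 1]. *)
  apply/nbhs_ballP; exists (Num.min d (Num.min t (1 - t))) => /=.
    by rewrite !lt_min d0 t0 subr_gt0.
  move=> s; rewrite /ball /= sub0r normrN !lt_min => /and3P[sd st s1] s0.
  rewrite /= [s *: 1]mulr1.
  have := hA (s + t); rewrite /= addrK; apply.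
  - by rewrite /ball /= opprD addrCA subrr addr0 normrN.
  - by rewrite -subr_eq0 addrK.
  - move: st s1; rewrite !ltr_norml => /andP[st _] /andP[_ s1].
    rewrite in_itv /= -(opprK t) subr_ge0 (ltW st) /= opprK.
    by rewrite -lerBrDr ltW.
by apply: DeriveDef; [apply/cvg_ex; eexists; exact: hl | exact: cvg_lim].
Qed.

(** Since g s differs from g t for s != t, the quotient of f o g is a genuine product of two
    quotients, and g carries punctured neighbourhoods of t to punctured ones of g t. *)
Lemma deriv01_comp (R : realType) (V : normedModType R) (f : R -> V)
    (g : R -> R) (t : R) : `[0, 1]%classic t -> maps01 g ->
  (forall s, `[0, 1]%classic s -> s != t -> g s != g t) ->
  derivable01 (g : R -> R^o) t -> derivable01 f (g t) ->
  derivable01 (f \o g) t /\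
  deriv01 (f \o g) t = deriv01 (g : R -> R^o) t *: deriv01 f (g t).
Proof.
move=> t01 g01 ginj dg df; apply: cvg_deriv01 => //.
apply: (@cvg_trans _ ((fun s => ((s - t)^-1 * (g s - g t)) *:
   ((g s - g t)^-1 *: (f (g s) - f (g t)))) @ within `[0, 1] t^')).
  apply: near_eq_cvg; apply/nbhs_ballP; exists 1 => //= s _ st s01.
  by rewrite scalerA -mulrA divff ?mulr1 // subr_eq0 ginj.
apply: cvgZ; first exact: deriv01_cvg dg.
have gc : g @ within `[0, 1] t^' --> within `[0, 1] (g t)^'.
  move=> A /nbhs_ballP[e /= e0 eA].
  move: (derivable01_cvg dg) => /cvgrPdist_lt/(_ _ e0)/nbhs_ballP[d /= d0 h].
  apply/nbhs_ballP; exists d => //= s sd st s01; apply: eA.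
  - exact: h.
  - exact: ginj.
  - exact: g01.
by move=> A /(deriv01_cvg df) /gc.
Qed.

Lemma deriv01_eq (R : realType) (V : normedModType R) (f1 f2 : R -> V) (t : R) :
  `[0, 1]%classic t -> (forall s, `[0, 1]%classic s -> f1 s = f2 s) ->
  derivable01 f1 t -> derivable01 f2 t /\ deriv01 f2 t = deriv01 f1 t.
Proof.
move=> t01 f12 /deriv01_cvg d1; apply: cvg_deriv01 => //.
apply: cvg_trans d1; apply: near_eq_cvg.
by apply/nbhs_ballP; exists 1 => //= s _ st s01; rewrite !f12.
Qed.

Lemma deriv01_id (R : realType) (t : R) : `[0, 1]%classic t ->
  derivable01 (id : R -> R^o) t /\ deriv01 (id : R -> R^o) t = 1.
Proof.
move=> t01; apply: cvg_deriv01 => //.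
apply: (@cvg_trans _ ((fun s => 1 : R^o) @ within `[0, 1] t^')).
  apply: near_eq_cvg; apply/nbhs_ballP; exists 1 => //= s _ st s01.
  by rewrite /GRing.scale /= mulVf ?subr_eq0.
exact: cvg_cst.
Qed.

Lemma deriv01Z (R : realType) (V : normedModType R) (f : R -> V) (c t : R) :
  `[0, 1]%classic t -> derivable01 f t ->
  derivable01 (fun s => c *: f s) t /\
  deriv01 (fun s => c *: f s) t = c *: deriv01 f t.
Proof.
move=> t01 /deriv01_cvg d1; apply: cvg_deriv01 => //.
rewrite /quot01; under eq_fun do rewrite -scalerBr scalerA mulrC -scalerA.
by apply: cvgZ => //; exact: cvg_cst.
Qed.

Lemma deriv01B (R : realType) (V : normedModType R) (f g : R -> V) (t : R) :
  `[0, 1]%classic t -> derivable01 f t -> derivable01 g t ->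
  derivable01 (fun s => f s - g s) t /\
  deriv01 (fun s => f s - g s) t = deriv01 f t - deriv01 g t.
Proof.
move=> t01 /deriv01_cvg d1 /deriv01_cvg d2; apply: cvg_deriv01 => //.
rewrite /quot01; under eq_fun do rewrite opprD addrACA -opprD scalerBr.
exact: cvgB.
Qed.

(** * The Euclidean inner product *)

Lemma cvg_dot (R : realType) (F : set_system R) {FF : Filter F}
    (u v : R -> 'rV[R]_3) (a b : 'rV[R]_3) :
  u @ F --> a -> v @ F --> b -> (fun s => dot (u s) (v s)) @ F --> dot a b.
Proof.
move=> ua vb; have uv i : (u s 0 i * v s 0 i) @[s --> F] --> a 0 i * b 0 i.
  apply: cvgM => A.
    by move=> /(@coord_continuous _ 1 3 0 i a A) /ua.
  by move=> /(@coord_continuous _ 1 3 0 i b A) /vb.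
rewrite /dot !big_ord_recl big_ord0.
under eq_fun do rewrite !big_ord_recl big_ord0.
by do !apply: cvgD => //; exact: cvg_cst.
Qed.

Section dot.
Context {R : realType}.
Implicit Types u v w : 'rV[R]_3.

Lemma dotC u v : dot u v = dot v u.
Proof. by apply: eq_bigr => i _; rewrite mulrC. Qed.

Lemma dotDl u v w : dot (u + v) w = dot u w + dot v w.
Proof. by rewrite -big_split; apply: eq_bigr => i _; rewrite mxE mulrDl. Qed.

Lemma dotZl c u v : dot (c *: u) v = c * dot u v.
Proof. by rewrite /dot mulr_sumr; apply: eq_bigr => i _; rewrite mxE mulrA. Qed.

Lemma dotZr c u v : dot u (c *: v) = c * dot u v.
Proof. by rewrite !(dotC u) dotZl. Qed.

Lemma dotBl u v w : dot (u - v) w = dot u w - dot v w.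
Proof. by rewrite dotDl -scaleN1r dotZl mulN1r. Qed.

Lemma dotBr u v w : dot u (v - w) = dot u v - dot u w.
Proof. by rewrite !(dotC u) dotBl. Qed.

Lemma dot_eq0 u : dot u u = 0 -> u = 0.
Proof.
move=> /eqP; rewrite psumr_eq0 => [/allP h|i _]; last by rewrite -expr2 sqr_ge0.
apply/rowP => i; rewrite mxE.
by have := h i (mem_index_enum i); rewrite mulf_eq0 orbb => /eqP.
Qed.

Lemma enormZ c u : 0 <= c -> enorm (c *: u) = c * enorm u.
Proof.
move=> c0; rewrite /enorm dotZl dotZr mulrA -expr2 sqrtrM ?sqr_ge0//.
by rewrite sqrtr_sqr ger0_norm.
Qed.

End dot.

(** Difference of two squares: by symmetry, the increment of [dot u u] from t to s is the product of
    u s + u t with u s - u t. *)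
Lemma deriv01_dotuu (R : realType) (u : R -> 'rV[R]_3) (t : R) :
  `[0, 1]%classic t -> derivable01 u t ->
  derivable01 ((fun s => dot (u s) (u s)) : R -> R^o) t /\
  deriv01 ((fun s => dot (u s) (u s)) : R -> R^o) t =
  2 * dot (u t) (deriv01 u t).
Proof.
move=> t01 du; apply: cvg_deriv01 => //.
have -> : 2 * dot (u t) (deriv01 u t) = dot (u t + u t) (deriv01 u t).
  by rewrite dotDl mulr2n mulrDl mul1r.
have uc := derivable01_cvg du.
apply: (@cvg_trans _ ((fun s => dot (u s + u t)
  ((s - t)^-1 *: (u s - u t))) @ within `[0, 1] t^')); last first.
  exact: cvg_dot (cvgD uc (cvg_cst (u t))) (deriv01_cvg du).
apply: near_eq_cvg; apply/nbhs_ballP; exists 1 => //= s _ st s01.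
rewrite dotZr; congr (_ * _).
by rewrite dotDl !dotBr (dotC (u t) (u s)) addrA subrK.
Qed.

Lemma deriv01_eq0_cst (R : realType) (f : R -> R) (a b : R) :
  (forall t, `[0, 1]%classic t -> derivable01 (f : R -> R^o) t) ->
  (forall t, `[0, 1]%classic t -> deriv01 (f : R -> R^o) t = 0) ->
  `[0, 1]%classic a -> `[0, 1]%classic b -> f a = f b.
Proof.
move=> df f'0; wlog ab : a b / a <= b.
  move=> H a01 b01; have [ab|/ltW ab] := leP a b; first exact: H.
  by apply/esym/H.
rewrite /= !in_itv /= => /andP[a0 a1] /andP[b0 b1].
have fd x : x \in `]a, b[ -> is_derive x 1 f (deriv01 (f : R -> R^o) x).
  rewrite in_itv /= => /andP[ax xb].
  have x0 := le_lt_trans a0 ax; have x1 := lt_le_trans xb b1.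
  apply: deriv01_is_derive; first by rewrite x0.
  by apply: df; rewrite /= in_itv /= !ltW.
have [c] := MVT_segment ab fd (derivable01_continuous a0 b1 df).
rewrite in_itv /= => /andP[ac cb].
rewrite f'0 ?mul0r; last first.
  by rewrite /= in_itv /= (le_trans a0 ac) (le_trans cb).
by move=> /eqP; rewrite subr_eq0 => /eqP.
Qed.

(** * Parallel transport *)

Section parallel_transport.
Context {R : realType}.
Implicit Types (beta V W : R -> 'rV[R]_3) (v w : 'rV[R]_3) (g h : R -> R).

Lemma parallelZ beta V (c : R) : parallel beta V ->
  parallel beta (fun t => c *: V t).
Proof.
move=> pV t t01; have [tV dV cV] := pV t t01.
have [dcV ecV] := deriv01Z c t01 dV.
split; [by rewrite /tangent /= dotZr tV mulr0 | exact: dcV |].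
by rewrite /covderiv01 ecV dotZr -scalerA -scalerBr [X in _ *: X]cV scaler0.
Qed.

Lemma parallelB beta V W : parallel beta V -> parallel beta W ->
  parallel beta (fun t => V t - W t).
Proof.
move=> pV pW t t01; have [tV dV cV] := pV t t01; have [tW dW cW] := pW t t01.
have [dVW eVW] := deriv01B t01 dV dW.
split; [by rewrite /tangent /= dotBr tV tW subrr | exact: dVW |].
rewrite /covderiv01 eVW dotBr scalerBl opprD addrACA -opprD.
by rewrite [X in X - _]cV [X in _ - X]cW subrr.
Qed.

(* The derivative of a parallel field is normal to the field, so the norm of
   the difference of two parallel fields is constant. *)
Lemma parallel_unique beta V W (a b : R) :
  `[0, 1]%classic a -> `[0, 1]%classic b ->
  parallel beta V -> parallel beta W -> V a = W a -> V b = W b.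
Proof.
move=> a01 b01 pV pW VWa; have pU := parallelB pV pW.
set U := (fun t => V t - W t) in pU.
suff : dot (U b) (U b) = 0.
  by move=> /dot_eq0 /eqP; rewrite subr_eq0 => /eqP.
rewrite -(@deriv01_eq0_cst _ (fun t => dot (U t) (U t)) a b) //.
- by rewrite /U VWa subrr -[X in dot X](scale0r 0) dotZl mul0r.
- by move=> t t01; have [_ /(deriv01_dotuu t01)[]] := pU t t01.
- move=> t t01; have [tU dU cU] := pU t t01.
  have [_ ->] := deriv01_dotuu t01 dU.
  move: cU => /eqP; rewrite subr_eq0 => /eqP ->.
  by rewrite dotZr (dotC (U t)) tU !mulr0.
Qed.

Lemma transportE beta V (a b : R) :
  `[0, 1]%classic a -> `[0, 1]%classic b -> parallel beta V ->
  transport beta a b (V a) = V b.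
Proof.
move=> a01 b01 pV; apply: xget_unique; first by exists V.
by move=> w [W [pW Wa <-]]; exact: (parallel_unique a01 b01 pW pV Wa).
Qed.

Lemma transportN beta v (a b : R) :
  ~ (exists2 V, parallel beta V & V a = v) -> transport beta a b v = 0.
Proof.
by move=> nV; apply: xgetPN => w [V [pV Va _]]; apply: nV; exists V.
Qed.

(** Scaling by c and by its inverse matches the parallel fields through v with those through c v. If
    there are none, both sides are the default 0. *)
Lemma transportZ beta v (a b c : R) :
  `[0, 1]%classic a -> `[0, 1]%classic b -> c != 0 ->
  transport beta a b (c *: v) = c *: transport beta a b v.
Proof.
move=> a01 b01 c0.
have [[V pV <-]|nV] := pselect (exists2 V, parallel beta V & V a = v).
  by rewrite (transportE a01 b01 pV) (transportE a01 b01 (parallelZ c pV)).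
rewrite !transportN ?scaler0// => -[V pV Va]; apply: nV.
exists (fun t => c^-1 *: V t); first exact: parallelZ.
by rewrite Va scalerA mulVf ?scale1r.
Qed.

(** The covariant derivative is linear in the derivative of the field, so by the chain rule it is
    only multiplied by g'. *)
Lemma parallel_comp beta V g : diffeo01 g -> parallel beta V ->
  parallel (beta \o g) (V \o g).
Proof.
move=> [g01 sg [h [h01 sh hg gh]]] pV t t01.
have [tV dV cV] := pV _ (g01 _ t01).
have ginj s : `[0, 1]%classic s -> s != t -> g s != g t.
  by move=> s01; apply: contra_neq => /(congr1 h); rewrite !hg.
have [dVg eVg] := deriv01_comp t01 g01 ginj (sg 0%N t t01) dV.
split; [exact: tV | exact: dVg |].
rewrite /covderiv01 eVg /= dotZr -scalerA -scalerBr.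
by rewrite [X in _ *: X]cV scaler0.
Qed.

Lemma parallel_eq beta1 beta2 V :
  (forall t, `[0, 1]%classic t -> beta1 t = beta2 t) ->
  parallel beta1 V -> parallel beta2 V.
Proof.
by move=> e pV t t01; rewrite /covderiv01 -e//; exact: pV.
Qed.

Lemma diffeo01_inv g : diffeo01 g -> exists h, [/\ diffeo01 h,
  forall t : R, `[0, 1]%classic t -> h (g t) = t &
  forall t : R, `[0, 1]%classic t -> g (h t) = t].
Proof.
move=> [g01 sg [h [h01 sh hg gh]]]; exists h.
by split => //; split => //; exists g.
Qed.

(** Composition with g and with its inverse h exchanges the parallel fields along beta and along
    beta o g. As g o h is the identity on [0, 1] only, [parallel_eq] closes the gap. *)
Lemma transport_comp beta g v (a b : R) : diffeo01 g ->
  `[0, 1]%classic a -> `[0, 1]%classic b ->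
  transport (beta \o g) a b v = transport beta (g a) (g b) v.
Proof.
move=> dg a01 b01; congr (xget 0 _); apply/seteqP; split => w /= [V [pV Va Vb]].
  have [h [dh hg gh]] := diffeo01_inv dg.
  exists (V \o h); rewrite /= !hg//; split => //.
  by apply: parallel_eq (parallel_comp dh pV) => t t01 /=; rewrite gh.
by exists (V \o g); split => //; exact: parallel_comp.
Qed.

End parallel_transport.

(** * Reparametrisations *)

Section Gamma.
Context {R : realType}.
Implicit Types g h : R -> R.

Lemma diffeo01_derivable g t : diffeo01 g -> `[0, 1]%classic t ->
  derivable01 (g : R -> R^o) t.
Proof. by move=> [_ sg _]; exact: (sg 0%N). Qed.

(** Chain rule for h o g, compared with the identity on [0, 1] by [deriv01_eq]. *)
Lemma diffeo01_deriv_inv g h t : diffeo01 g -> diffeo01 h ->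
  (forall t : R, `[0, 1]%classic t -> h (g t) = t) ->
  `[0, 1]%classic t ->
  deriv01 (g : R -> R^o) t * deriv01 (h : R -> R^o) (g t) = 1.
Proof.
move=> dg dh hg t01; have g01 : maps01 g by case: dg.
have ginj s : `[0, 1]%classic s -> s != t -> g s != g t.
  by move=> s01; apply: contra_neq => /(congr1 h); rewrite !hg.
have [_ e] := deriv01_comp t01 g01 ginj (diffeo01_derivable dg t01)
  (diffeo01_derivable dh (g01 _ t01)).
have [di ei] := deriv01_id t01.
have [_ e'] := deriv01_eq (f2 := (h : R -> R^o) \o g) t01
  (fun s s01 => esym (hg s s01)) di.
exact: (etrans (esym e) (etrans e' ei)).
Qed.

Lemma Gamma_inv g : Gamma g -> exists h, [/\ Gamma h,
  forall t : R, `[0, 1]%classic t -> h (g t) = t &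
  forall t : R, `[0, 1]%classic t -> g (h t) = t].
Proof.
move=> [g0 g1 dg]; have [h [dh hg gh]] := diffeo01_inv dg.
exists h; split => //; split => //.
  by rewrite -[in LHS]g0 hg//= in_itv /= lexx ler01.
by rewrite -[in LHS]g1 hg//= in_itv /= lexx ler01.
Qed.

(** A continuous injection on a segment is monotone, and the endpoint values fix its direction. *)
Lemma Gamma_le g : Gamma g -> {in `[0, 1] &, {mono g : x y / x <= y}}.
Proof.
move=> Gg; have [h [_ hg _]] := Gamma_inv Gg; case: Gg => [g0 g1 dg].
apply: segment_continuous_inj_le.
- by rewrite g0 g1.
- apply: (@derivable01_continuous R R^o) => // t t01.
  exact: diffeo01_derivable.
- by move=> x y x01 y01 /(congr1 h); rewrite !hg.
Qed.

(** The derivative is nonzero because g has a differentiable inverse, and nonnegative as a limit of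
    quotients of an increasing function. *)
Lemma Gamma_deriv_gt0 g t : Gamma g -> `[0, 1]%classic t ->
  0 < deriv01 (g : R -> R^o) t.
Proof.
move=> Gg t01; have [h [[_ _ dh] hg _]] := Gamma_inv Gg.
have dg : diffeo01 g by case: Gg.
rewrite lt_def; apply/andP; split.
  apply/eqP => g'0; have := diffeo01_deriv_inv dg dh hg t01.
  by rewrite g'0 mul0r => /esym/eqP; rewrite oner_eq0.
have dgt := diffeo01_derivable dg t01; have ? := within01_proper t01.
have gl : (s - t)^-1 * (g s - g t) @[s --> within `[0, 1] t^'] -->
    (deriv01 (g : R -> R^o) t : R) by exact: deriv01_cvg dgt.
rewrite -(cvg_lim (@Rhausdorff R) gl).
apply: limr_ge; first by apply/cvg_ex; eexists; exact: gl.
apply/nbhs_ballP; exists 1 => //= s _ st s01.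
have gs : {in `[0, 1] &, {mono g : x y / x <= y}} by exact: Gamma_le.
have [ts|/ltW ts] := leP t s.
  by rewrite mulr_ge0 ?invr_ge0 ?subr_ge0 ?gs.
by rewrite mulr_le0 ?invr_le0 ?subr_le0 ?gs.
Qed.

(** The velocity gains the factor g' and its normalisation the factor 1 / sqrt g', which leaves sqrt
    g'. The transport back along alpha o g is the one along alpha from g t to g 0 = 0. *)
Lemma tsrvc_comp (alpha : R -> 'rV[R]_3) g t : trajectory alpha -> Gamma g ->
  `[0, 1]%classic t ->
  tsrvc (alpha \o g) t =
  Num.sqrt (deriv01 (g : R -> R^o) t) *: tsrvc alpha (g t).
Proof.
move=> [sa _] Gg t01; have g'0 := Gamma_deriv_gt0 Gg t01.
have [h [_ hg _]] := Gamma_inv Gg; case: Gg => [g0 g1 dg].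
have g01 : maps01 g by case: dg.
have ginj s : `[0, 1]%classic s -> s != t -> g s != g t.
  by move=> s01; apply: contra_neq => /(congr1 h); rewrite !hg.
have [_ e] := deriv01_comp t01 g01 ginj (diffeo01_derivable dg t01)
  (sa 0%N _ (g01 _ t01)).
(* As g' > 0, both velocities vanish together, so both sides take the same branch. *)
rewrite /tsrvc e /= scaler_eq0 gt_eqF //=; case: ifPn => [_|a'0].
  by rewrite scaler0.
have ? : `[0, 1]%classic (0 : R) by rewrite /= in_itv /= lexx ler01.
rewrite transport_comp// g0 -transportZ//; last 2 first.
- exact: g01.
- by rewrite gt_eqF ?sqrtr_gt0.
congr (transport _ _ _ _); rewrite enormZ ?(ltW g'0)// sqrtrM ?(ltW g'0)//.
rewrite !scalerA; congr (_ *: _); rewrite invfM mulrAC; congr (_ * _).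
(* What remains is c / sqrt c = sqrt c. *)
set c := deriv01 _ _ in g'0 *.
by rewrite -[X in _ * X](sqr_sqrtr (ltW g'0)) expr2 mulKf// gt_eqF ?sqrtr_gt0.
Qed.

End Gamma.

(** * Change of variables *)

Section substitution.
Context {R : realType}.
Implicit Types g h : R -> R.
Local Notation mu := (@lebesgue_measure R).
Local Notation D := (`[0, 1]%classic : set R).
Local Notation "g ^'01" := (deriv01 (g : R -> R^o)) (at level 8).

Lemma smooth01_measurable g : smooth01 (g : R -> R^o) -> measurable_fun D g.
Proof.
move=> sg; apply: subspace_continuous_measurable_fun => //.
by apply: (@derivable01_continuous R R^o) => //; exact: (sg 0%N).
Qed.

Lemma smooth01_deriv g : smooth01 (g : R -> R^o) ->
  smooth01 (g^'01 : R -> R^o).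
Proof. by move=> sg n; rewrite -iterSr; exact: sg. Qed.

Lemma Gamma_smooth g : Gamma g -> smooth01 (g : R -> R^o).
Proof. by move=> [_ _ []]. Qed.

Lemma Gamma_measurable_deriv g : Gamma g ->
  measurable_fun D (fun t => (g^'01 t)%:E).
Proof.
move=> Gg; apply/measurable_EFinP.
by apply: smooth01_measurable; apply: smooth01_deriv; exact: Gamma_smooth.
Qed.

(** Fundamental theorem of calculus with g 0 = 0. The interval is half-open to match the preimages
    of open rays in [Gamma_measureE]. *)
Lemma integral_Gamma_deriv g (b : R) : Gamma g -> 0 < b <= 1 ->
  (\int[mu]_(t in `[0%R, b[) (g^'01 t)%:E = (g b)%:E)%E.
Proof.
move=> Gg /andP[b0 b1]; have sg := Gamma_smooth Gg.
have dg t : D t -> derivable01 (g : R -> R^o) t := sg 0%N t.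
have gd t : t \in `]0, b[ -> is_derive t 1 g (g^'01 t).
  rewrite in_itv /= => /andP[t0 tb].
  apply: deriv01_is_derive; first by rewrite t0 (lt_le_trans tb).
  by apply: dg; rewrite /= in_itv /= !ltW// (lt_le_trans tb).
rewrite integral_itv_bndo_bndc; last first.
  apply: measurable_funS (Gamma_measurable_deriv Gg) => //.
  by apply: subset_itv; rewrite bnd_simp.
rewrite (@continuous_FTC2 _ _ g)//.
- by case: Gg => -> _ _; rewrite sube0.
- apply: (@derivable01_continuous R R^o) => //.
  exact: (@smooth01_deriv _ sg 0%N).
- have gc := @derivable01_continuous R R^o g 0 b (lexx _) b1 dg.
  split.
  + by move=> t /gd[].
  + by have [] := (continuous_within_itvP g b0).1 gc.
  + by have [] := (continuous_within_itvP g b0).1 gc.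
- by move=> t /gd[_ <-]; rewrite derive1E.
Qed.

Section Gamma_measure.
Variables (g : R -> R) (Gg : Gamma g).

(** Pushforward by g of the measure with density g' on [0, 1]. The proof of [Gamma g] is an argument
    so that the measure instance, which relies on g' >= 0, can be attached to this constant. *)
Definition Gamma_measure & Gamma g : set (measurableTypeR R) -> \bar R :=
  fun A => (\int[mu]_(t in D `&` g @^-1` A) (g^'01 t)%:E)%E.

Local Notation nu := (Gamma_measure Gg).

Let nu_ge0 A : (0 <= nu A)%E.
Proof.
apply: integral_ge0 => t [t01 _].
by rewrite lee_fin ltW// Gamma_deriv_gt0.
Qed.

Let nu0 : nu set0 = 0%E.
Proof. by rewrite /Gamma_measure preimage_set0 setI0 integral_set0. Qed.

Let mDg A : measurable A -> measurable (D `&` g @^-1` A).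
Proof.
by move=> mA; apply: (smooth01_measurable (Gamma_smooth Gg)).
Qed.

Let nu_sigma_additive : semi_sigma_additive nu.
Proof.
move=> /= F mF tF mUF; apply: cvg_toP.
  by apply: ereal_nondecreasing_is_cvgn => m n mn; apply: lee_sum_nneg_natr.
rewrite /Gamma_measure preimage_bigcup setI_bigcupr ge0_integral_bigcup//=.
- by move=> k; exact: (mDg (mF k)).
- rewrite -setI_bigcupr.
  exact: measurable_funS (Gamma_measurable_deriv Gg).
- by move=> t [k _ [t01 _]]; rewrite lee_fin ltW// Gamma_deriv_gt0.
- apply/trivIsetP => i j _ _ ij.
  move/trivIsetP : tF => /(_ i j Logic.I Logic.I ij) Fij.
  by rewrite setIACA setIid -preimage_setI Fij preimage_set0 setI0.
Qed.

HB.instance Definition _ := isMeasure.Build _ _ _ nu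
  nu0 nu_ge0 nu_sigma_additive.

(** The open rays form a pi-system that generates the Borel sets and exhausts the line, so it
    suffices to compare the two measures on them. *)
Lemma Gamma_measureE A : measurable A -> nu A = mu (D `&` A).
Proof.
move=> mA; have mD : measurable (D : set (measurableTypeR R)) by [].
rewrite setIC -[RHS]/(mrestr mu mD A).
have [h [Gh hg gh]] := Gamma_inv Gg.
have [g0 g1 [g01 _ _]] := Gg; have [h0 h1 [h01 _ _]] := Gh.
have gle := Gamma_le Gg; have glt := leW_mono_in gle.
pose m1 : {measure set (measurableTypeR R) -> \bar R} := mrestr mu mD.
pose m2 : {measure set (measurableTypeR R) -> \bar R} := nu.
suff : m1 A = m2 A by move=> m12; exact/esym/m12.
apply: (@measure_unique _ R (measurableTypeR R) (@RGenInftyO.G R)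
  (fun k => `]-oo, k%:R[%classic) _ _ _ _ m1 m2 _ _ A mA).
- exact: RGenInftyO.measurableE.
- move=> _ _ [x ->] [y ->]; exists (Num.min x y).
  by apply/seteqP; split => t /=; rewrite !in_itv /= lt_min => /andP.
- by move=> k; exists k%:R.
- rewrite -subTset -(@bigcup_itvT R true true); apply: subset_bigcup => k _.
  by apply: subset_itv; rewrite bnd_simp.
- move=> _ [x ->].
  rewrite -[LHS]/(mu (`]-oo, x[%classic `&` D)) -[RHS]/(nu `]-oo, x[%classic).
  (* For x <= 0 both sets are empty. For 0 < x <= 1 they are [0, x[ and [0, h x[, of equal mass
     because g (h x) = x. For x > 1 both are [0, 1], of mass g 1 = 1. *)
  have [x0|x0] := leP x 0.
    rewrite [X in mu X](_ : _ = set0); last first.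
      rewrite -subset0 => t /=; rewrite !in_itv /= => -[tx /andP[t0 _]].
      by have := lt_le_trans tx x0; rewrite ltNge t0.
    rewrite measure0 /Gamma_measure.
    rewrite [X in (\int[_]_(_ in X) _)%E](_ : _ = set0) ?integral_set0//.
    rewrite -subset0 => t /= [t01]; rewrite in_itv /=.
    move=> gx; have := g01 _ t01; rewrite /= in_itv /= => /andP[gt0 _].
    by have := lt_le_trans gx x0; rewrite ltNge gt0.
  have [x1|x1] := leP x 1.
    have x01 : D x by rewrite /= in_itv /= ltW.
    rewrite [X in mu X](_ : _ = `[0, x[%classic); last first.
      apply/seteqP; split => t /=; rewrite !in_itv /=.
        by move=> [-> /andP[->]].
      by move=> /andP[-> tx]; rewrite tx (ltW (lt_le_trans tx x1)).
    rewrite lebesgue_measure_itv /= lte_fin x0 sube0.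
    have hx0 : 0 < h x.
      by rewrite lt_def; apply/andP; split; [apply/eqP => /(congr1 g)|];
        [rewrite gh// g0 => x00; move: x0; rewrite x00 ltxx|
         have := h01 _ x01; rewrite /= in_itv /= => /andP[]].
    have hx1 : h x <= 1 by have := h01 _ x01; rewrite /= in_itv /= => /andP[].
    rewrite /Gamma_measure.
    rewrite [X in (\int[_]_(_ in X) _)%E](_ : _ = `[0, h x[%classic);
      last first.
      apply/seteqP; split => t /=; rewrite !in_itv /=.
        move=> [/andP[t0 t1]]; rewrite -[X in _ < X](gh x x01) glt ?in_itv /=.
        - by rewrite t0.
        - by rewrite t0.
        - exact: h01.
      move=> /andP[t0 tx]; have t1 := ltW (lt_le_trans tx hx1).
      by rewrite t0 t1 -[X in _ < X](gh x x01) glt ?in_itv /= ?t0//; exact: h01.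
    by rewrite integral_Gamma_deriv ?hx0// gh.
  rewrite [X in mu X](_ : _ = D); last first.
    apply/seteqP; split => t /=; rewrite !in_itv /=; first by case.
    by move=> /andP[-> t1]; rewrite t1 (le_lt_trans t1).
  rewrite lebesgue_measure_itv /= lte_fin ltr01 sube0.
  rewrite /Gamma_measure [X in (\int[_]_(_ in X) _)%E](_ : _ = D); last first.
    apply/seteqP; split => t /=; rewrite !in_itv /=; first by case.
    move=> t01; split => //; apply: le_lt_trans x1.
    by have := g01 t; rewrite /= !in_itv /= => /(_ t01) /andP[].
  rewrite -integral_itv_bndo_bndc; last first.
    apply: measurable_funS (Gamma_measurable_deriv Gg) => //.
    by apply: subset_itv; rewrite bnd_simp.
  by rewrite integral_Gamma_deriv ?lexx ?ltr01// g1.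
- move=> k; apply: (@le_lt_trans _ _ (mu D)); first exact: measureIr.
  by rewrite lebesgue_measure_itv /= lte_fin ltr01 ltry.
Qed.

End Gamma_measure.

(** Split f along its level sets: each value y contributes y times the mass of its level set, and
    [Gamma_measureE] equates the two masses. *)
Lemma Gamma_integral_nnsfun g (f : {nnsfun (measurableTypeR R) >-> R}) :
  Gamma g ->
  (\int[mu]_(t in D) (f (g t) * g^'01 t)%:E = \int[mu]_(t in D) (f t)%:E)%E.
Proof.
move=> Gg; pose A y := f @^-1` [set y].
have mD : measurable (D : set (measurableTypeR R)) by [].
have mA y : measurable (A y) by exact: measurable_funPTI.
have mg' := Gamma_measurable_deriv Gg.
have g'0 t : D t -> 0 <= g^'01 t by move=> t01; rewrite ltW// Gamma_deriv_gt0.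
(* [ge0_integral_fsum] wants nonnegative terms for every real y, including those outside the range
   of f. *)
have A0 y : y < 0 -> A y = set0 by move=> y0; rewrite /A preimage_nnfun0.
transitivity (\sum_(y \in range f) (y%:E * Gamma_measure Gg (A y)))%E.
  transitivity (\int[mu]_(t in D)
      \sum_(y \in range f) (y%:E * ((\1_(A y) (g t) * g^'01 t)%:E)))%E.
    apply: eq_integral => t _; rewrite (fimfunE f (g t)) mulr_fsuml -fsumEFin//.
    by apply: eq_fsbigr => y _; rewrite -EFinM mulrA.
  have indE y : (fun t => (\1_(A y) (g t) * g^'01 t)%:E) =
      (fun t => (g^'01 t)%:E) \_ (g @^-1` A y).
    apply/funext => t; rewrite patchE indicE.
    case: ifPn => [/set_mem Agt|/negP nA]; first by rewrite mem_set// mul1r.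
    by rewrite memNset ?mul0r// => Agt; apply: nA; exact: mem_set.
  have mind y : measurable_fun D (fun t => (\1_(A y) (g t) * g^'01 t)%:E).
    apply/measurable_EFinP/measurable_funM; last exact/(measurable_EFinP D).
    have m1 : measurable_fun setT (\1_(A y) : measurableTypeR R -> R).
      exact: measurable_indic.
    exact: (measurableT_comp m1 (smooth01_measurable (Gamma_smooth Gg))).
  rewrite ge0_integral_fsum//; last 2 first.
  - by move=> y; exact: (measurable_funeM _ (mind y)).
  - move=> y t Dt; have [y0|y0] := leP 0 y.
      by rewrite -EFinM lee_fin !mulr_ge0// g'0.
    by rewrite A0// indic0 mul0r mule0.
  apply: eq_fsbigr => y; rewrite inE /= => -[x _ <-].
  rewrite ge0_integralZl//; last 3 first.
  - exact: mind.
  - by move=> t Dt; rewrite lee_fin mulr_ge0// g'0.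
  - by rewrite lee_fin.
  by rewrite /Gamma_measure integral_mkcondr indE.
transitivity (\sum_(y \in range f) (y%:E * mu (A y `&` D)))%E.
  by apply: eq_fsbigr => y _; rewrite Gamma_measureE// setIC.
transitivity (\int[mu]_(t in D)
    \sum_(y \in range f) ((y * \1_(A y) t)%:E))%E; last first.
  by apply: eq_integral => t _; rewrite (fimfunE f t) -fsumEFin.
rewrite ge0_integral_fsum//; last 2 first.
- by move=> y; apply/measurable_EFinP/measurable_funM.
- move=> y t Dt; have [y0|y0] := leP 0 y; first by rewrite lee_fin mulr_ge0.
  by rewrite A0// indic0 mulr0.
apply: eq_fsbigr => y _.
by rewrite integralZl_indic_nnsfun// integral_indic.
Qed.

(** Every simple function below f1 is below f2, so the suprema compare, for nonmeasurable functions
    as well. *)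
Lemma ge0_le_integral_subset (S : set R) (f1 f2 : R -> \bar R) :
  (forall t, S t -> 0 <= f1 t)%E -> (forall t, S t -> f1 t <= f2 t)%E ->
  (\int[mu]_(t in S) f1 t <= \int[mu]_(t in S) f2 t)%E.
Proof.
move=> f10 f12; rewrite !ge0_integralE//; last first.
  by move=> t St; rewrite (le_trans (f10 _ St))// f12.
apply: ereal_sup_le => _ [h hf1 <-]; exists h => //= t.
apply: le_trans (hf1 t) _; rewrite !patchE; case: ifPn => // /set_mem.
exact: f12.
Qed.

(** If a simple f lies below Phi on [0, 1], then (f o g) g' lies below (Phi o g) g' there and has
    the same integral as f. *)
Lemma Gamma_integral_le g (Phi : R -> R) : Gamma g ->
  (forall t, 0 <= Phi t) ->
  (\int[mu]_(t in D) (Phi t)%:E <=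
   \int[mu]_(t in D) (Phi (g t) * g^'01 t)%:E)%E.
Proof.
move=> Gg Phi0; have g01 : maps01 g by case: Gg => _ _ [].
have g'0 t : D t -> 0 <= g^'01 t by move=> t01; rewrite ltW// Gamma_deriv_gt0.
rewrite [leLHS]ge0_integralE; last by move=> t _; rewrite lee_fin.
apply: ge_ereal_sup => _ [f fPhi <-].
rewrite -integralT_nnsfun.
(* Outside [0, 1], f is squeezed between 0 and the zero extension of Phi. *)
have -> : (\int[mu]_t (f t)%:E = \int[mu]_(t in D) (f t)%:E)%E.
  rewrite [RHS]integral_mkcond; apply: eq_integral => t _; rewrite patchE.
  case: ifPn => // tD; have := fPhi t; rewrite patchE (negbTE tD) lee_fin => f0.
  by congr EFin; apply/le_anti; rewrite f0 /=.
rewrite -(Gamma_integral_nnsfun f Gg); apply: ge0_le_integral_subset => t Dt.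
  by rewrite lee_fin mulr_ge0// g'0.
rewrite lee_fin ler_wpM2r// ?g'0//.
by have := fPhi (g t); rewrite patchE mem_set ?lee_fin//; exact: g01.
Qed.

(** The converse inequality is [Gamma_integral_le] for the inverse h and the function (Phi o g) g':
    composing with h and multiplying by h' gives back Phi, as g'(h t) h'(t) = 1. *)
Lemma Gamma_integral g (Phi : R -> R) : Gamma g -> (forall t, 0 <= Phi t) ->
  (\int[mu]_(t in D) (Phi (g t) * g^'01 t)%:E =
   \int[mu]_(t in D) (Phi t)%:E)%E.
Proof.
move=> Gg Phi0; apply/eqP; rewrite eq_le Gamma_integral_le// andbT.
have [h [Gh hg gh]] := Gamma_inv Gg.
have [_ _ dg] := Gg; have [_ _ dh] := Gh.
(* The absolute value makes [Psi] nonnegative outside [0, 1] too. *)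
pose Psi t := Phi (g t) * `|g^'01 t|.
have Psi0 t : 0 <= Psi t by rewrite /Psi mulr_ge0.
have e t : D t -> Phi (g t) * g^'01 t = Psi t.
  by move=> Dt; rewrite /Psi gtr0_norm// Gamma_deriv_gt0.
under eq_integral => t /set_mem Dt do rewrite e//.
apply: le_trans (Gamma_integral_le Gh Psi0) _.
rewrite le_eqVlt; apply/orP; left; apply/eqP.
apply: eq_integral => t /set_mem Dt.
have Dht : D (h t) by case: dh => h01 _ _; exact: h01.
rewrite -e// gh// -mulrA [X in _ * X]mulrC.
by rewrite (diffeo01_deriv_inv dh dg gh Dt) mulr1.
Qed.

End substitution.

Theorem theorem1 (R : realType) (alpha1 alpha2 : R -> 'rV[R]_3) (gamma : R -> R)
  (halpha1 : trajectory alpha1) (halpha2 : trajectory alpha2)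
  (hgamma : Gamma gamma) :
  repr_dist (alpha1 0, tsrvc (alpha1 \o gamma))
            (alpha2 0, tsrvc (alpha2 \o gamma)) =
  repr_dist (alpha1 0, tsrvc alpha1) (alpha2 0, tsrvc alpha2).
Proof.
rewrite /repr_dist /=.
(* Both infima range over the same curves, since the base points agree; the costs are compared curve
   by curve. *)
apply: (congr1 (@ereal_inf R)); apply: eq_imagel => beta _.
apply: (congr1 (fun z => sqrte (sqlength beta + z)%E)).
pose Phi t := enorm (transport beta 0 1 (tsrvc alpha1 t) - tsrvc alpha2 t) ^+ 2.
have Phi0 t : 0 <= Phi t by rewrite sqr_ge0.
rewrite -[RHS](Gamma_integral hgamma Phi0).
apply: eq_integral => t /set_mem t01.
rewrite (tsrvc_comp halpha1 hgamma t01) (tsrvc_comp halpha2 hgamma t01).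
have g'0 := Gamma_deriv_gt0 hgamma t01.
have O01 : `[0, 1]%classic (0 : R) by rewrite /= in_itv /= lexx ler01.
have I01 : `[0, 1]%classic (1 : R) by rewrite /= in_itv /= lexx ler01.
have c0 : Num.sqrt (deriv01 (gamma : R -> R^o) t) != 0.
  by rewrite gt_eqF ?sqrtr_gt0.
(* The common factor sqrt(gamma') leaves the transport, the difference and the norm, and squares to
   gamma'. *)
rewrite (transportZ _ _ O01 I01 c0) -scalerBr enormZ ?sqrtr_ge0//.
by rewrite exprMn (sqr_sqrtr (ltW g'0)) mulrC.
Qed.
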